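(* Let $(A,\mu,\alpha,\beta)$ be a regular BiHom-algebra over $\mathbb{K}$. Define bilinear maps on $A$ by $$\{x,y\}=\tfrac12\Big(\mu(x,y)-\mu(\alpha^{-1}\beta(y),\alpha\beta^{-1}(x))\Big),\qquad x\bullet y=\tfrac12\Big(\mu(x,y)+\mu(\alpha^{-1}\beta(y),\alpha\beta^{-1}(x))\Big).$$ Then the polarization $P(A)=(A,\{\cdot,\cdot\},\bullet,\alpha,\beta)$ is a regular BiHom-Poisson algebra if and only if $(A,\mu,\alpha,\beta)$ is an admissible BiHom-Poisson algebra.
   Context: $\mathbb{K}$ is a field of characteristic zero. Composition of maps is written by juxtaposition. A BiHom-algebra is a quadruple $(A,\mu,\alpha,\beta)$ with $A$ a $\mathbb{K}$-vector space, $\mu:A\times A\to A$ bilinear and $\alpha,\beta:A\to A$ commuting linear maps that are multiplicative, i.e. $\alpha(\mu(x,y))=\mu(\alpha(x),\alpha(y))$ and $\beta(\mu(x,y))=\mu(\beta(x),\beta(y))$. A BiHom-algebra (or a BiHom-Poisson algebra) is regular if $\alpha$ and $\beta$ are bijective. The BiHom-associator is $$as_{\alpha,\beta}(x,y,z)=\mu(\mu(x,y),\beta(z))-\mu(\alpha(x),\mu(y,z)).$$ A BiHom-algebra $(A,\mu,\alpha,\beta)$ is an admissible BiHom-Poisson algebra if for all $x,y,z\in A$ $$as_{\alpha,\beta}(\beta(x),\alpha(y),\alpha^2(z))=\tfrac13\Big\{\mu(\mu(\beta(x),\alpha\beta(z)),\alpha^2(y))-\mu(\mu(\beta^2(z),\alpha(x)),\alpha^2(y))+\mu(\mu(\beta(y),\alpha\beta(z)),\alpha^2(x))-\mu(\mu(\beta(y),\alpha(x)),\alpha^2\beta(z))\Big\}.$$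 A BiHom-Poisson algebra is a 5-tuple $(A,\{\cdot,\cdot\},\bullet,\alpha,\beta)$ with $A$ a $\mathbb{K}$-vector space, $\{\cdot,\cdot\},\bullet:A\times A\to A$ bilinear and $\alpha,\beta:A\to A$ linear, such that the following hold for all $x,y,z\in A$: (1) $(A,\{\cdot,\cdot\},\alpha,\beta)$ is a BiHom-Lie algebra: $\alpha\beta=\beta\alpha$, $\alpha(\{x,y\})=\{\alpha(x),\alpha(y)\}$, $\beta(\{x,y\})=\{\beta(x),\beta(y)\}$, $\{\beta(x),\alpha(y)\}=-\{\beta(y),\alpha(x)\}$, and $\{\beta^2(x),\{\beta(y),\alpha(z)\}\}+\{\beta^2(y),\{\beta(z),\alpha(x)\}\}+\{\beta^2(z),\{\beta(x),\alpha(y)\}\}=0$; (2) $(A,\bullet,\alpha,\beta)$ is a BiHom-commutative BiHom-associative algebra: $\alpha(x\bullet y)=\alpha(x)\bullet\alpha(y)$, $\beta(x\bullet y)=\beta(x)\bullet\beta(y)$, $\alpha(x)\bullet(y\bullet z)=(x\bullet y)\bullet\beta(z)$, and $\beta(x)\bullet\alpha(y)=\beta(y)\bullet\alpha(x)$; (3) $\{x\bullet y,\alpha\beta(z)\}=\{x,\beta(z)\}\bullet\alpha(y)+\alpha(x)\bullet\{y,\alpha(z)\}$. *)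

(* Defs.v *)
From mathcomp Require Import all_boot all_order all_algebra.

Set Implicit Arguments.
Unset Strict Implicit.
Unset Printing Implicit Defensive.

Import GRing.Theory.
Local Open Scope ring_scope.

Section BijectiveInverse.
Variables (S : choiceType) (T : eqType) (f : S -> T).

Lemma bij_surj (bf : bijective f) (y : T) : exists x, f x == y.
Proof. by case: bf => g _ gK; exists (g y); rewrite gK. Qed.

(* Since [bijective f] lives in Prop, the inverse function is extracted with
   the choice operator of [S]. *)
Definition bij_inv (bf : bijective f) (y : T) : S := xchoose (bij_surj bf y).

Lemma bij_invKV (bf : bijective f) : cancel (bij_inv bf) f.
Proof. by move=> y; apply/eqP; apply: (xchooseP (bij_surj bf y)). Qed.

Lemma bij_invK (bf : bijective f) : cancel f (bij_inv bf).
Proof. by move=> x; apply: (bij_inj bf); rewrite bij_invKV. Qed.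

End BijectiveInverse.

Section BiHom.
Variables (K : fieldType) (A : lmodType K).
Implicit Types (mu br dot : A -> A -> A) (alpha beta : A -> A).

Record bihom_algebra mu alpha beta : Prop := BiHomAlgebra {
  bihom_bilinear : bilinear_for *:%R *:%R mu;
  bihom_linear_alpha : linear alpha;
  bihom_linear_beta : linear beta;
  bihom_comm : forall x, alpha (beta x) = beta (alpha x);
  bihom_mult_alpha : forall x y, alpha (mu x y) = mu (alpha x) (alpha y);
  bihom_mult_beta : forall x y, beta (mu x y) = mu (beta x) (beta y)
}.

Definition regular alpha beta : Prop := bijective alpha /\ bijective beta.

Definition bihom_associator mu alpha beta (x y z : A) : A :=
  mu (mu x y) (beta z) - mu (alpha x) (mu y z).

Definition admissible_bihom_poisson mu alpha beta : Prop :=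
  bihom_algebra mu alpha beta /\
  forall x y z : A,
    bihom_associator mu alpha beta (beta x) (alpha y) (alpha (alpha z)) =
    3%:R^-1 *:
      (mu (mu (beta x) (alpha (beta z))) (alpha (alpha y))
       - mu (mu (beta (beta z)) (alpha x)) (alpha (alpha y))
       + mu (mu (beta y) (alpha (beta z))) (alpha (alpha x))
       - mu (mu (beta y) (alpha x)) (alpha (alpha (beta z)))).

(* The (bi)linearity of the operations and twisting maps is required once and
   for all in [bihom_poisson] below. *)
Record bihom_lie br alpha beta : Prop := BiHomLie {
  lie_comm : forall x, alpha (beta x) = beta (alpha x);
  lie_mult_alpha : forall x y, alpha (br x y) = br (alpha x) (alpha y);
  lie_mult_beta : forall x y, beta (br x y) = br (beta x) (beta y);
  lie_skew : forall x y, br (beta x) (alpha y) = - br (beta y) (alpha x);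
  lie_jacobi : forall x y z,
    br (beta (beta x)) (br (beta y) (alpha z))
    + br (beta (beta y)) (br (beta z) (alpha x))
    + br (beta (beta z)) (br (beta x) (alpha y)) = 0
}.

Record bihom_comm_assoc dot alpha beta : Prop := BiHomCommAssoc {
  ca_mult_alpha : forall x y, alpha (dot x y) = dot (alpha x) (alpha y);
  ca_mult_beta : forall x y, beta (dot x y) = dot (beta x) (beta y);
  ca_assoc : forall x y z,
    dot (alpha x) (dot y z) = dot (dot x y) (beta z);
  ca_comm : forall x y, dot (beta x) (alpha y) = dot (beta y) (alpha x)
}.

Record bihom_poisson br dot alpha beta : Prop := BiHomPoisson {
  poisson_bilinear_br : bilinear_for *:%R *:%R br;
  poisson_bilinear_dot : bilinear_for *:%R *:%R dot;
  poisson_linear_alpha : linear alpha;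
  poisson_linear_beta : linear beta;
  poisson_lie : bihom_lie br alpha beta;
  poisson_comm_assoc : bihom_comm_assoc dot alpha beta;
  poisson_leibniz : forall x y z,
    br (dot x y) (alpha (beta z)) =
    dot (br x (beta z)) (alpha y) + dot (alpha x) (br y (alpha z))
}.

Section Polarization.
Variables (mu : A -> A -> A) (alpha beta : A -> A) (reg : regular alpha beta).
Let alphaV : A -> A := bij_inv reg.1.
Let betaV : A -> A := bij_inv reg.2.

Definition polar_bracket (x y : A) : A :=
  2%:R^-1 *: (mu x y - mu (alphaV (beta y)) (alpha (betaV x))).

Definition polar_prod (x y : A) : A :=
  2%:R^-1 *: (mu x y + mu (alphaV (beta y)) (alpha (betaV x))).

End Polarization.

End BiHom.

(* Main.v *)
From HB Require Import structures.
Require Import Defs.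
From mathcomp Require Import all_boot all_order all_algebra.
From mathcomp Require Import ring.

(** The theorem is the Markl-Remm description of Poisson algebras by a single
operation, transported along the twisting maps.

Untwisting.  When [alpha] and [beta] are bijective, put
m(x, y) = mu(alpha^-1 x, beta^-1 y), so that mu(x, y) = m(alpha x, beta y).
The maps [alpha] and [beta] are commuting automorphisms of [m], and

- {x, y} = 1/2 (m(X, Y) - m(Y, X)) and x . y = 1/2 (m(X, Y) + m(Y, X)), where
  X = alpha x and Y = beta y ([polar_bracket_untwist], [polar_prod_untwist]);
- in each BiHom axiom, pushing all twisting maps onto the variables leaves the
  classical axiom for [m], evaluated at alpha^i beta^j x, alpha^k beta^l y and
  alpha^p beta^q z.  As these elements are arbitrary, the BiHom axiom for [mu]
  and the classical axiom for [m] are equivalent ([admissible_untwist],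
  [poisson_untwist]).  The remaining axioms (multiplicativity, skew-symmetry,
  commutativity) hold for every [mu].

The untwisted statement.  Write A for the associator of [m], [x, y] for
xy - yx and x o y for xy + yx; all Poisson axioms are homogeneous of degree two
in the pair of operations, so the factors 1/2 do not matter.  The claim is that
the Jacobi, associativity and Leibniz identities for these two operations
amount to
            3 A(x, y, z) = (xz)y - (zx)y + (yz)x - (yx)z.          (MR)
One direction is a linear combination of the Poisson axioms
([markl_remm_of_poisson]).  Conversely, the right-hand side of (MR) changes
sign when x and z are exchanged, and its sum over cyclic permutations vanishes;
dividing by 3 gives both properties for A.  The three Poisson defects are
combinations of such flexibility and cyclic sums of A and of (MR)
([leibniz_defect_flexible], [assoc_defect_cyclic], [jacobi_defect_cyclic]). *)

Set Implicit Arguments.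
Unset Strict Implicit.
Unset Printing Implicit Defensive.

Import GRing.Theory.
Local Open Scope ring_scope.

(** * Deciding identities in an abelian group *)

(** The trivial square-zero extension of the integers by an abelian group.  It
embeds [V] additively into a commutative ring, where the [ring] tactic decides
integral linear identities between elements of [V]. *)
Definition square_zero_ext (V : zmodType) : Type := (int * V)%type.

Section SquareZeroExtension.

Variable V : zmodType.

HB.instance Definition _ := GRing.Zmodule.on (square_zero_ext V).

Implicit Types p q : square_zero_ext V.

Definition sqz_mul p q : square_zero_ext V :=
  (p.1 * q.1, q.2 *~ p.1 + p.2 *~ q.1).

Definition sqz_one : square_zero_ext V := (1, 0).

Fact sqz_mulA : associative sqz_mul.
Proof.
move=> [a u] [b v] [c w]; rewrite /sqz_mul /= mulrA; congr pair.
by rewrite !mulrzDl -!mulrzA addrA [b * a]mulrC [c * a]mulrC.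
Qed.

Fact sqz_mulC : commutative sqz_mul.
Proof. by move=> [a u] [b v]; rewrite /sqz_mul /= mulrC addrC. Qed.

Fact sqz_mul1 : left_id sqz_one sqz_mul.
Proof. by move=> [a u]; rewrite /sqz_mul /= mul1r mulr1z mul0rz addr0. Qed.

Fact sqz_mulDl : left_distributive sqz_mul +%R.
Proof.
move=> [a u] [b v] [c w]; congr pair; first exact: mulrDl.
by rewrite /= mulrzDr mulrzDl addrACA.
Qed.

Fact sqz_one_neq0 : sqz_one != 0.
Proof. by []. Qed.

HB.instance Definition _ :=
  GRing.Zmodule_isComNzRing.Build (square_zero_ext V)
    sqz_mulA sqz_mulC sqz_mul1 sqz_mulDl sqz_one_neq0.

Definition sqz_in (v : V) : square_zero_ext V := (0, v).

Fact sqz_in_is_zmod_morphism : zmod_morphism sqz_in.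
Proof. by move=> u v; congr pair; rewrite /= subr0. Qed.

HB.instance Definition _ :=
  GRing.isZmodMorphism.Build V (square_zero_ext V) sqz_in
    sqz_in_is_zmod_morphism.

Lemma sqz_in_inj : injective sqz_in.
Proof. by move=> u v []. Qed.

End SquareZeroExtension.

Ltac abelian_group := apply: sqz_in_inj; ring.

(** * Poisson algebras by one operation *)

Section MarklRemm.

Variables (V : zmodType) (m : V -> V -> V).

Definition commutator x y := m x y - m y x.

Definition anticommutator x y := m x y + m y x.

Definition associator x y z := m (m x y) z - m x (m y z).

(** The axioms are encoded by defects, which vanish when the axiom holds, so that
the linear dependencies between axioms are plain identities, valid for every
biadditive [m]. *)
Definition markl_remm_defect x y z :=
  associator x y z *+ 3
  - (m (m x z) y - m (m z x) y + m (m y z) x - m (m y x) z).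

Definition jacobi_defect x y z :=
  commutator x (commutator y z) + commutator y (commutator z x)
  + commutator z (commutator x y).

Definition assoc_defect x y z :=
  anticommutator (anticommutator x y) z - anticommutator x (anticommutator y z).

Definition leibniz_defect x y z :=
  commutator (anticommutator x y) z
  - (anticommutator (commutator x z) y + anticommutator x (commutator y z)).

Hypothesis mBl : forall x y z, m (x - y) z = m x z - m y z.
Hypothesis mBr : forall x y z, m x (y - z) = m x y - m x z.

Let mNl x y : m (- x) y = - m x y.
Proof.
have := mBl x x y; rewrite !subrr => m0.
by rewrite -sub0r mBl m0 sub0r.
Qed.

Let mNr x y : m x (- y) = - m x y.
Proof.
have := mBr x y y; rewrite !subrr => m0.
by rewrite -sub0r mBr m0 sub0r.
Qed.

Let mDl x y z : m (x + y) z = m x z + m y z.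
Proof. by rewrite -{1}[y]opprK mBl mNl opprK. Qed.

Let mDr x y z : m x (y + z) = m x y + m x z.
Proof. by rewrite -{1}[z]opprK mBr mNr opprK. Qed.

Ltac multilinear :=
  rewrite /markl_remm_defect /jacobi_defect /assoc_defect /leibniz_defect
    /associator /commutator /anticommutator ?(mDl, mDr, mNl, mNr);
  abelian_group.

(** Split xy into commutator and anticommutator in (MR): the associator of the
anticommutator, two instances of the Leibniz rule and one Jacobi sum account
for all the terms. *)
Lemma markl_remm_of_poisson x y z :
  markl_remm_defect x y z *+ 2 =
  assoc_defect x y z *+ 2 + leibniz_defect x y z *+ 2 + leibniz_defect y z x
  - jacobi_defect x y z.
Proof. multilinear. Qed.

Lemma flexible_of_markl_remm x y z :
  (associator x y z + associator z y x) *+ 3 =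
  markl_remm_defect x y z + markl_remm_defect z y x.
Proof. multilinear. Qed.

Lemma cyclic_of_markl_remm x y z :
  (associator x y z + associator y z x + associator z x y) *+ 3 =
  markl_remm_defect x y z + markl_remm_defect y z x + markl_remm_defect z x y.
Proof. multilinear. Qed.

Lemma leibniz_defect_flexible x y z :
  leibniz_defect x y z =
  (associator x y z + associator z y x) + (associator y x z + associator z x y)
  - (associator x z y + associator y z x).
Proof. multilinear. Qed.

Lemma jacobi_defect_cyclic x y z :
  jacobi_defect x y z =
  (associator y x z + associator x z y + associator z y x)
  - (associator x y z + associator y z x + associator z x y).
Proof. multilinear. Qed.

(** Modulo flexibility, the left-hand side is
2 A(x, y, z) - A(y, z, x) - A(z, x, y) minus the right-hand side of (MR), and
(MR) replaces the latter by 3 A(x, y, z): a cyclic sum is left. *)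
Lemma assoc_defect_cyclic x y z :
  assoc_defect x y z =
  markl_remm_defect x y z + (associator x z y + associator y z x)
  - (associator x y z + associator z y x)
  - (associator x y z + associator y z x + associator z x y).
Proof. multilinear. Qed.

Theorem markl_remm (tf6 : forall v : V, v *+ 6 = 0 -> v = 0) :
  (forall x y z, [/\ jacobi_defect x y z = 0, assoc_defect x y z = 0
                   & leibniz_defect x y z = 0])
  <-> (forall x y z, markl_remm_defect x y z = 0).
Proof.
have tf2 (v : V) : v *+ 2 = 0 -> v = 0.
  by move=> v2; apply: tf6; rewrite (mulrnA v 2 3) v2 mul0rn.
have tf3 (v : V) : v *+ 3 = 0 -> v = 0.
  by move=> v3; apply: tf6; rewrite (mulrnA v 3 2) v3 mul0rn.
split=> [P x y z | MR].
  have [J As L] := P x y z; have [_ _ L'] := P y z x; apply: tf2.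
  by rewrite markl_remm_of_poisson J As L L' !mul0rn !addr0 subr0.
have flex x y z : associator x y z + associator z y x = 0.
  by apply: tf3; rewrite flexible_of_markl_remm !MR addr0.
have cyc x y z : associator x y z + associator y z x + associator z x y = 0.
  by apply: tf3; rewrite cyclic_of_markl_remm !MR !addr0.
move=> x y z; split.
- by rewrite jacobi_defect_cyclic !cyc subrr.
- by rewrite assoc_defect_cyclic MR !flex cyc !addr0 !subr0.
- by rewrite leibniz_defect_flexible !flex !addr0 subr0.
Qed.

End MarklRemm.

(** * Removing the twists *)

Section Untwist.

Variables (K : fieldType) (A : lmodType K).
Variables (mu : A -> A -> A) (alpha beta : A -> A).
Hypotheses (HA : bihom_algebra mu alpha beta) (reg : regular alpha beta).

Let alphaV : A -> A := bij_inv reg.1.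
Let betaV : A -> A := bij_inv reg.2.

Definition untwist x y := mu (alphaV x) (betaV y).
Local Notation m := untwist.

Let alphaKV : cancel alphaV alpha. Proof. exact: bij_invKV. Qed.
Let betaKV : cancel betaV beta. Proof. exact: bij_invKV. Qed.
Let alphaK : cancel alpha alphaV. Proof. exact: bij_invK. Qed.
Let betaK : cancel beta betaV. Proof. exact: bij_invK. Qed.
Let comm x : alpha (beta x) = beta (alpha x). Proof. exact: bihom_comm HA x. Qed.

Lemma untwistK x y : mu x y = m (alpha x) (beta y).
Proof. by rewrite /m alphaK betaK. Qed.

Lemma alpha_untwist x y : alpha (m x y) = m (alpha x) (alpha y).
Proof.
rewrite /m (bihom_mult_alpha HA) alphaKV alphaK; congr mu.
by apply: (can_inj betaK); rewrite -comm !betaKV.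
Qed.

Lemma beta_untwist x y : beta (m x y) = m (beta x) (beta y).
Proof.
rewrite /m (bihom_mult_beta HA) betaKV betaK; congr mu.
by apply: (can_inj alphaK); rewrite comm !alphaKV.
Qed.

Lemma alpha_linear : linear alpha. Proof. exact: bihom_linear_alpha HA. Qed.
Lemma beta_linear : linear beta. Proof. exact: bihom_linear_beta HA. Qed.

Lemma untwist_linear_l y : linear (m^~ y).
Proof.
move=> c u v; rewrite -(bihom_bilinear HA).1; congr mu.
by apply: (can_inj alphaK); rewrite alpha_linear !alphaKV.
Qed.

Lemma untwist_linear_r x : linear (m x).
Proof.
move=> c u v; rewrite -(bihom_bilinear HA).2; congr mu.
by apply: (can_inj betaK); rewrite beta_linear !betaKV.
Qed.

Lemma untwistBl x y z : m (x - y) z = m x z - m y z.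
Proof. exact: (zmod_morphism_linear (untwist_linear_l z)). Qed.

Lemma untwistBr x y z : m x (y - z) = m x y - m x z.
Proof. exact: (zmod_morphism_linear (untwist_linear_r x)). Qed.

Lemma commutator_linear_l y : linear (commutator m ^~ y).
Proof.
move=> c u v; rewrite /commutator untwist_linear_l untwist_linear_r.
by rewrite opprD addrACA -scalerBr.
Qed.

Lemma commutator_linear_r x : linear (commutator m x).
Proof.
move=> c u v; rewrite /commutator untwist_linear_l untwist_linear_r.
by rewrite opprD addrACA -scalerBr.
Qed.

Lemma anticommutator_linear_l y : linear (anticommutator m ^~ y).
Proof.
move=> c u v; rewrite /anticommutator untwist_linear_l untwist_linear_r.
by rewrite addrACA -scalerDr.
Qed.

Lemma anticommutator_linear_r x : linear (anticommutator m x).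
Proof.
move=> c u v; rewrite /anticommutator untwist_linear_l untwist_linear_r.
by rewrite addrACA -scalerDr.
Qed.

Local Notation br := (polar_bracket mu reg).
Local Notation dot := (polar_prod mu reg).

Lemma polar_bracket_untwist x y :
  br x y = 2%:R^-1 *: commutator m (alpha x) (beta y).
Proof. by rewrite /polar_bracket !untwistK alphaKV -comm betaKV. Qed.

Lemma polar_prod_untwist x y :
  dot x y = 2%:R^-1 *: anticommutator m (alpha x) (beta y).
Proof. by rewrite /polar_prod !untwistK alphaKV -comm betaKV. Qed.

Let alphaZ : scalable alpha. Proof. exact: scalable_linear alpha_linear. Qed.
Let betaZ : scalable beta. Proof. exact: scalable_linear beta_linear. Qed.

Let commutatorZl y : scalable (commutator m ^~ y).
Proof. exact: scalable_linear (commutator_linear_l y). Qed.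
Let commutatorZr x : scalable (commutator m x).
Proof. exact: scalable_linear (commutator_linear_r x). Qed.
Let anticommutatorZl y : scalable (anticommutator m ^~ y).
Proof. exact: scalable_linear (anticommutator_linear_l y). Qed.
Let anticommutatorZr x : scalable (anticommutator m x).
Proof. exact: scalable_linear (anticommutator_linear_r x). Qed.

Let alphaD x y : alpha (x + y) = alpha x + alpha y.
Proof. by have := alpha_linear 1 x y; rewrite !scale1r. Qed.
Let betaD x y : beta (x + y) = beta x + beta y.
Proof. by have := beta_linear 1 x y; rewrite !scale1r. Qed.
Let alphaB : zmod_morphism alpha.
Proof. exact: zmod_morphism_linear alpha_linear. Qed.
Let betaB : zmod_morphism beta.
Proof. exact: zmod_morphism_linear beta_linear. Qed.

Lemma alpha_commutator x y :
  alpha (commutator m x y) = commutator m (alpha x) (alpha y).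
Proof. by rewrite /commutator alphaB !alpha_untwist. Qed.

Lemma beta_commutator x y :
  beta (commutator m x y) = commutator m (beta x) (beta y).
Proof. by rewrite /commutator betaB !beta_untwist. Qed.

Lemma alpha_anticommutator x y :
  alpha (anticommutator m x y) = anticommutator m (alpha x) (alpha y).
Proof. by rewrite /anticommutator alphaD !alpha_untwist. Qed.

Lemma beta_anticommutator x y :
  beta (anticommutator m x y) = anticommutator m (beta x) (beta y).
Proof. by rewrite /anticommutator betaD !beta_untwist. Qed.

Let twistE := (alphaZ, betaZ, alpha_commutator, beta_commutator,
  alpha_anticommutator, beta_anticommutator, comm).

Let polarE := (polar_bracket_untwist, polar_prod_untwist).

Lemma polar_bilinear :
  bilinear_for *:%R *:%R br /\ bilinear_for *:%R *:%R dot.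
Proof.
split; split=> w c u v /=.
- rewrite !polarE alpha_linear commutator_linear_l.
  by rewrite scalerDr !scalerA [c * _]mulrC.
- rewrite !polarE beta_linear commutator_linear_r.
  by rewrite scalerDr !scalerA [c * _]mulrC.
- rewrite !polarE alpha_linear anticommutator_linear_l.
  by rewrite scalerDr !scalerA [c * _]mulrC.
- rewrite !polarE beta_linear anticommutator_linear_r.
  by rewrite scalerDr !scalerA [c * _]mulrC.
Qed.

Lemma polar_mult_alpha x y :
  alpha (br x y) = br (alpha x) (alpha y)
  /\ alpha (dot x y) = dot (alpha x) (alpha y).
Proof. by rewrite !polarE !twistE. Qed.

Lemma polar_mult_beta x y :
  beta (br x y) = br (beta x) (beta y)
  /\ beta (dot x y) = dot (beta x) (beta y).
Proof. by rewrite !polarE !twistE. Qed.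

Lemma polar_skew x y : br (beta x) (alpha y) = - br (beta y) (alpha x).
Proof. by rewrite !polarE !twistE -scalerN /commutator opprB. Qed.

Lemma polar_comm x y : dot (beta x) (alpha y) = dot (beta y) (alpha x).
Proof. by rewrite !polarE !twistE /anticommutator addrC. Qed.

Lemma polar_jacobi_untwist x y z :
  br (beta (beta x)) (br (beta y) (alpha z))
  + br (beta (beta y)) (br (beta z) (alpha x))
  + br (beta (beta z)) (br (beta x) (alpha y)) =
  (2%:R^-1 * 2%:R^-1) *: jacobi_defect m (beta (beta (alpha x)))
    (beta (beta (alpha y))) (beta (beta (alpha z))).
Proof. by rewrite !polarE !twistE !commutatorZr !scalerA -!scalerDr. Qed.

Lemma polar_assoc_untwist x y z :
  dot (dot x y) (beta z) - dot (alpha x) (dot y z) =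
  (2%:R^-1 * 2%:R^-1) *: assoc_defect m (alpha (alpha x))
    (beta (alpha y)) (beta (beta z)).
Proof.
by rewrite !polarE !twistE anticommutatorZr anticommutatorZl !scalerA -scalerBr.
Qed.

Lemma polar_leibniz_untwist x y z :
  br (dot x y) (alpha (beta z))
  - (dot (br x (beta z)) (alpha y) + dot (alpha x) (br y (alpha z))) =
  (2%:R^-1 * 2%:R^-1) *: leibniz_defect m (alpha (alpha x))
    (beta (alpha y)) (beta (beta (alpha z))).
Proof.
rewrite !polarE !twistE commutatorZl anticommutatorZl anticommutatorZr.
by rewrite !scalerA -scalerDr -scalerBr.
Qed.

Hypothesis charK0 : [pchar K] =i pred0.

Let natr_neq0 n : (n.+1%:R : K) != 0.
Proof. by rewrite ((pcharf0P K).1 charK0). Qed.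

Let scale4_eq0 (v : A) : (2%:R^-1 * 2%:R^-1 : K) *: v = 0 -> v = 0.
Proof.
by move/eqP; rewrite scaler_eq0 mulf_eq0 invr_eq0 (negPf (natr_neq0 1)) => /eqP.
Qed.

(** Left to right, the twisted arguments of each defect are arbitrary elements because
[alpha] and [beta] are onto. *)
Lemma poisson_untwist :
  bihom_poisson br dot alpha beta <->
  (forall x y z, [/\ jacobi_defect m x y z = 0, assoc_defect m x y z = 0
                   & leibniz_defect m x y z = 0]).
Proof.
split=> [P x y z | P].
  have [bb_a aa ba bb] : [/\ forall u, exists v, u = beta (beta (alpha v)),
      forall u, exists v, u = alpha (alpha v),
      forall u, exists v, u = beta (alpha v)
      & forall u, exists v, u = beta (beta v)].
    split=> u.
    - by exists (alphaV (betaV (betaV u))); rewrite alphaKV !betaKV.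
    - by exists (alphaV (alphaV u)); rewrite !alphaKV.
    - by exists (alphaV (betaV u)); rewrite alphaKV betaKV.
    - by exists (betaV (betaV u)); rewrite !betaKV.
  split; apply: scale4_eq0.
  - have [[x' ->] [y' ->] [z' ->]] := And3 (bb_a x) (bb_a y) (bb_a z).
    by rewrite -polar_jacobi_untwist (lie_jacobi (poisson_lie P)).
  - have [[x' ->] [y' ->] [z' ->]] := And3 (aa x) (ba y) (bb z).
    rewrite -polar_assoc_untwist (ca_assoc (poisson_comm_assoc P)).
    exact: subrr.
  - have [[x' ->] [y' ->] [z' ->]] := And3 (aa x) (ba y) (bb_a z).
    by rewrite -polar_leibniz_untwist (poisson_leibniz P) subrr.
have [bil_br bil_dot] := polar_bilinear.
split=> //; [exact: alpha_linear | exact: beta_linear | split | split |].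
- exact: comm.
- by move=> x y; have [] := polar_mult_alpha x y.
- by move=> x y; have [] := polar_mult_beta x y.
- exact: polar_skew.
- move=> x y z; rewrite polar_jacobi_untwist.
  by case: (P (beta (beta (alpha x))) (beta (beta (alpha y)))
              (beta (beta (alpha z)))) => -> _ _; rewrite scaler0.
- by move=> x y; have [] := polar_mult_alpha x y.
- by move=> x y; have [] := polar_mult_beta x y.
- move=> x y z; apply/esym/eqP; rewrite -subr_eq0 polar_assoc_untwist.
  by case: (P (alpha (alpha x)) (beta (alpha y)) (beta (beta z)))
    => _ -> _; rewrite scaler0.
- exact: polar_comm.
- move=> x y z; apply/eqP; rewrite -subr_eq0 polar_leibniz_untwist.
  by case: (P (alpha (alpha x)) (beta (alpha y)) (beta (beta (alpha z))))
    => _ _ ->; rewrite scaler0.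
Qed.

Lemma admissible_defect_untwist x y z :
  bihom_associator mu alpha beta (beta x) (alpha y) (alpha (alpha z))
  - 3%:R^-1 *:
      (mu (mu (beta x) (alpha (beta z))) (alpha (alpha y))
       - mu (mu (beta (beta z)) (alpha x)) (alpha (alpha y))
       + mu (mu (beta y) (alpha (beta z))) (alpha (alpha x))
       - mu (mu (beta y) (alpha x)) (alpha (alpha (beta z)))) =
  3%:R^-1 *: markl_remm_defect m (beta (alpha (alpha x)))
    (beta (alpha (alpha y))) (beta (beta (alpha (alpha z)))).
Proof.
rewrite /bihom_associator /markl_remm_defect [RHS]scalerBr -scaler_nat scalerA.
rewrite mulVf ?natr_neq0 // scale1r !untwistK.
by rewrite !(alpha_untwist, beta_untwist, comm).
Qed.

Lemma admissible_untwist :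
  admissible_bihom_poisson mu alpha beta <->
  (forall x y z, markl_remm_defect m x y z = 0).
Proof.
split=> [[_ P] x y z | P].
  have scale3_eq0 (v : A) : 3%:R^-1 *: v = 0 -> v = 0.
    by move/eqP; rewrite scaler_eq0 invr_eq0 (negPf (natr_neq0 2)) => /eqP.
  pose t u := alphaV (alphaV (betaV u)).
  have tK u : beta (alpha (alpha (t u))) = u by rewrite !alphaKV betaKV.
  apply: scale3_eq0; rewrite -(tK x) -(tK y) -(betaKV z) -(tK (betaV z)).
  by rewrite -admissible_defect_untwist P subrr.
split=> // x y z; apply/eqP; rewrite -subr_eq0 admissible_defect_untwist.
by rewrite P scaler0.
Qed.

End Untwist.

Theorem theorem4p1 (K : fieldType) (charK0 : [pchar K] =i pred0)
    (A : lmodType K) (mu : A -> A -> A) (alpha beta : A -> A)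
    (HA : bihom_algebra mu alpha beta) (reg : regular alpha beta) :
  (bihom_poisson (polar_bracket mu reg) (polar_prod mu reg) alpha beta
     /\ regular alpha beta)
  <-> admissible_bihom_poisson mu alpha beta.
Proof.
have tf6 (v : A) : v *+ 6 = 0 -> v = 0.
  move/eqP; rewrite -scaler_nat scaler_eq0 ((pcharf0P K).1 charK0).
  by move/eqP.
have MR := markl_remm (untwistBl HA reg) (untwistBr HA reg) tf6.
rewrite (poisson_untwist HA reg charK0) (admissible_untwist HA reg charK0) MR.
by split=> [[] | ].
Qed.
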